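(* Let $a_U,a_E\ge1$, let $(\tilde w_k)_{k\in\mathbb N}$ be an $(a_U,a_E)$-minimising sequence of $E$, and let $(n_k)_{k\in\mathbb N}$ be a strictly increasing sequence in $\mathbb N$. Let $(\mathbb U^n)_{n\in\mathbb N}$ be closed convex subsets of $\mathbb H$, and let $(u_n)$, $(v_n)$ be computed by the refining subset FISTA algorithm, where $u_n\in\mathbb U^{n+1}$ for all $n\in\mathbb N$ and where $$\tilde w_k\in\mathbb U^{n_k}\cap\mathbb U^{n_k+1}\cap\dots\cap\mathbb U^{n_{k+1}-1}\qquad\text{for all }k\in\mathbb N .$$ Assume the FISTA stepsize satisfies $t_n\simeq n$. Suppose that either: - $a_U>1$ and $n_k^2\simeq a_E^ka_U^{2k}$, or - $a_U=1$, $\sum_{k=1}^\infty n_k^2a_E^{-k}<\infty$ and $\sum_{k=1}^\infty\|\tilde w_k-\tilde w_{k+1}\|<\infty$. Then $$E_0(u_N)\lesssim\frac1{N^{2(1-\kappa)}}\quad\text{uniformly for }N\in\mathbb N,\qquad\text{where }\kappa=\frac{\log a_U^2}{\log a_E+\log a_U^2}.$$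
   Context: Here $\mathbb N=\{0,1,2,\dots\}$. $\mathbb H$ is a real Hilbert space with inner product $\langle\cdot,\cdot\rangle$ and norm $\|\cdot\|$. $f:\mathbb H\to\mathbb R$ is convex and differentiable with $1$-Lipschitz gradient, $g:\mathbb H\to\mathbb R\cup\{+\infty\}$ is proper, convex and weakly lower semicontinuous, $E=f+g$ is bounded below, and $E_0(u)=E(u)-\inf_{\mathbb H}E$. It is not assumed that $E$ attains its infimum. For sequences, $a_n\lesssim b_n$ means there exist $C,N_0>0$ with $a_n\le Cb_n$ for all $n>N_0$; $a_n\simeq b_n$ means $a_n\lesssim b_n\lesssim a_n$. For $a_U,a_E\ge1$, a sequence $(\tilde w_k)_{k\in\mathbb N}$ in $\mathbb H$ is an $(a_U,a_E)$-minimising sequence of $E$ if $\|\tilde w_k\|\lesssim a_U^k$ and $E_0(\tilde w_k)\lesssim a_E^{-k}$. FISTA stepsize: a real sequence $(t_n)_{n\ge1}$ with $t_1=1$, $t_n\ge1$ and $\rho_n:=t_n^2-t_{n+1}^2+t_{n+1}\ge0$ for all $n\ge1$. Refining subset FISTA algorithm: given closed convex sets $\mathbb U^n\subset\mathbb H$ (each containing a point where $g$ is finite), $u_0\in\mathbb U^0$ and a FISTA stepsize, set $v_0=u_0$ and for $n=0,1,2,\dots$ $$\bar u_n=\Big(1-\tfrac1{t_{n+1}}\Big)u_n+\tfrac1{t_{n+1}}v_n,\qquad u_{n+1}=\operatorname*{argmin}_{u\in\mathbb U^{n+1}}\tfrac12\|u-\bar u_n+\nabla f(\bar u_n)\|^2+g(u),\qquad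 v_{n+1}=(1-t_{n+1})u_n+t_{n+1}u_{n+1}.$$ *)

(* Defs.v *)
From HB Require Import structures.
From mathcomp Require Import all_boot all_order all_algebra.
From mathcomp Require Import sesquilinear.
From mathcomp Require Import all_classical all_reals all_analysis.

Set Implicit Arguments.
Unset Strict Implicit.
Unset Printing Implicit Defensive.
Import Order.TTheory GRing.Theory Num.Theory.
Import numFieldNormedType.Exports.

Local Open Scope classical_set_scope.
Local Open Scope ring_scope.
Local Open Scope convex_scope.

Section Asymptotics.
Context {R : realType}.
Implicit Types a b : nat -> \bar R.

Definition lesssim a b : Prop :=
  exists C : R, exists N0 : nat, [/\ 0 < C, (0 < N0)%N &
    forall n, (N0 < n)%N -> (a n <= C%:E * b n)%E].

Definition simeq a b : Prop := lesssim a b /\ lesssim b a.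

(* The constant works for every positive index, not only for large ones; index
   0 is left out because b is meant to be a negative power of the index. *)
Definition lesssim_uniformly a b : Prop :=
  exists2 C : R, 0 < C & forall n, (0 < n)%N -> (a n <= C%:E * b n)%E.

End Asymptotics.

Section HilbertSpace.
Context {R : realType} {H : completeNormedModType R}.

(* Makes (H, dot) a real Hilbert space: H is complete for its norm, and dot is
   symmetric, bilinear and positive definite by its type. *)
Definition induces_norm (dot : {dot H for (@idfun R)}) : Prop :=
  forall x : H, `|x| = Num.sqrt (dot x x).

(* By Riesz representation such a gradf exists, and is unique, as soon as f is
   differentiable everywhere. *)
Definition is_gradient (dot : {dot H for (@idfun R)}) (f : H -> R)
    (gradf : H -> H) : Prop :=
  forall x, differentiable f x /\ forall h, 'd f x h = dot (gradf x) h.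

(* The initial topology for this map into H -> R with the topology of pointwise
   convergence is the coarsest one making all the functionals dot h continuous,
   i.e. the weak topology of H. *)
Definition pairing (dot : {dot H for (@idfun R)}) : H -> {ptws H -> R} :=
  fun x h => dot h x.

Definition weakly_lower_semicontinuous (dot : {dot H for (@idfun R)})
    (g : H -> \bar R) : Prop :=
  lower_semicontinuous (g : initial_topology (pairing dot) -> \bar R).

Definition proper_efunction (g : H -> \bar R) : Prop :=
  (forall x, g x != -oo%E) /\ exists x, (g x < +oo)%E.

(* For g that never takes the value -oo the right-hand side is never oo - oo;
   moreover 0 * +oo = 0, so that the inequality is trivial for t = 0 and
   t = 1. *)
Definition convex_efunction (g : H -> \bar R) : Prop :=
  forall (t : {i01 R}) (x y : H),
    (g ((x : convex_lmodType H) <| t |> y)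
      <= t%:num%:E * g x + (1 - t%:num)%:E * g y)%E.

Definition bounded_below (F : H -> \bar R) : Prop :=
  exists m : R, forall x, (m%:E <= F x)%E.

Definition is_argmin (A : set H) (F : H -> \bar R) (x : H) : Prop :=
  A x /\ forall y, A y -> (F x <= F y)%E.

Definition energy (f : H -> R) (g : H -> \bar R) (x : H) : \bar R :=
  ((f x)%:E + g x)%E.

Definition energy_gap (f : H -> R) (g : H -> \bar R) (x : H) : \bar R :=
  (energy f g x - ereal_inf (range (energy f g)))%E.

Definition minimising_sequence (E0 : H -> \bar R) (aU aE : R) (w : nat -> H) :
    Prop :=
  lesssim (fun k => `|w k|%:E) (fun k => (aU ^+ k)%:E) /\
  lesssim (fun k => E0 (w k)) (fun k => (aE ^- k)%:E).

(* t 0 is irrelevant. *)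
Definition fista_stepsize (t : nat -> R) : Prop :=
  t 1%N = 1 /\
  forall n, (1 <= n)%N ->
    1 <= t n /\ 0 <= t n ^+ 2 - t n.+1 ^+ 2 + t n.+1.

Definition refining_fista (gradf : H -> H) (g : H -> \bar R)
    (U : nat -> set H) (t : nat -> R) (u v : nat -> H) : Prop :=
  [/\ U 0%N (u 0%N), v 0%N = u 0%N &
    forall n,
      let ubar := (1 - (t n.+1)^-1) *: u n + (t n.+1)^-1 *: v n in
      is_argmin (U n.+1)
        (fun x => (2^-1 * `|x - ubar + gradf ubar| ^+ 2)%:E + g x)%E
        (u n.+1) /\
      v n.+1 = (1 - t n.+1) *: u n + t n.+1 *: u n.+1].

End HilbertSpace.

(* Main.v *)
Require Import Defs.
From HB Require Import structures.
From mathcomp Require Import all_boot all_order all_algebra.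
From mathcomp Require Import sesquilinear.
From mathcomp Require Import all_classical all_reals all_analysis.
From mathcomp Require Import ring lra zify.

Set Implicit Arguments.
Unset Strict Implicit.
Unset Printing Implicit Defensive.
Import Order.TTheory GRing.Theory Num.Theory.
Import numFieldNormedType.Exports.

Local Open Scope classical_set_scope.
Local Open Scope ring_scope.

(** Write [e n = E (u n) - inf E]. An iteration minimises, over the convex set
    [U n.+1], a model of [E] that is tangent up to a quadratic; comparing its
    minimiser with a convex combination of [u n] and a point [x] of [U n.+1]
    gives the classical FISTA estimate ([fista_step],
    [refining_fista_step]): the Lyapunov function
    [t n ^+ 2 * e n + `|v n - x| ^+ 2 / 2] grows by at most
    [t n.+1 * (E x - inf E)]. As [E] need not have a minimiser, and as the
    sets change, no single centre [x] serves for all [n]: the centre is [w k]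
    while [n] runs through the [k]-th block, where [t n] is of order [n], and
    so the [k]-th block costs at most a multiple of
    [nk k.+1 ^+ 2 * aE ^- k].

    At the end of a block the centre moves from [w k] to [w k.+1]. The square
    root of the Lyapunov function behaves like a norm, so that this adds at
    most [`|w k - w k.+1|] to the root ([lyapunov_recentre]), whereas the cost
    of a block adds to the Lyapunov function itself. The bound
    [(p k + q k) ^+ 2] takes both into account when the squares of [p]
    collect the costs and [q] collects the moves ([restart_majorant]).

    If [1 < aU] then the costs are of order [aU ^+ (2 * k)] and the moves of
    order [aU ^+ k], so [p] and [q] can be taken geometric and
    [t n ^+ 2 * e n] is of order [aU ^+ (2 * k)] in the [k]-th block
    ([restart_geometric]). There [n ^+ 2] is at least of order
    [(aE * aU ^+ 2) ^+ k], whose power [kappa] is [aU ^+ (2 * k)]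
    ([le_kappa_power]); division by [t n ^+ 2], of order [n ^+ 2], gives the
    rate. If [aU = 1] then costs and moves are summable, [t n ^+ 2 * e n] is
    bounded ([restart_bounded]), and [kappa = 0]. *)

(** * Convex analysis in a real Hilbert space *)

Lemma le_of_small_steps {R : realType} (a b c : R) :
  (forall s : R, 0 < s <= 1 -> a <= b + s * c) -> a <= b.
Proof.
move=> abc; apply/ler_addgt0Pr => e e0.
have c1 : 0 < `|c| + 1 by rewrite ltr_wpDl.
pose s := Num.min 1 (e / (`|c| + 1)).
have s0 : 0 < s by rewrite lt_min ltr01 divr_gt0.
have /abc/le_trans : 0 < s <= 1 by rewrite s0 ge_min lexx.
apply; rewrite lerD2l.
apply: (@le_trans _ _ (s * (`|c| + 1))); last first.
  by rewrite -ler_pdivlMr// ge_min lexx orbT.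
by rewrite ler_pM2l// (le_trans (ler_norm c))// lerDl.
Qed.

Lemma convex_set_comb {R : realType} {H : lmodType R} (A : set H) (s : R)
    (x y : H) :
  convex_set A -> 0 <= s <= 1 -> A x -> A y -> A (s *: x + (1 - s) *: y).
Proof.
move=> cA /andP[s0 s1] /mem_set Ax /mem_set Ay; apply/set_mem.
exact: (cA x y (Itv01 s0 s1)).
Qed.

Lemma convex_efunction_comb {R : realType} {H : completeNormedModType R}
    (g : H -> \bar R) (s : R) (x y : H) :
  convex_efunction g -> 0 <= s <= 1 ->
  (g (s *: x + (1 - s) *: y)%R <= s%:E * g x + (1 - s)%:E * g y)%E.
Proof. by move=> cg /andP[s0 s1]; exact: (cg (Itv01 s0 s1) x y). Qed.

Section Hilbert.
Context {R : realType} {H : completeNormedModType R}.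
Variable dot : {dot H for (@idfun R)}.
Hypothesis hdot : induces_norm dot.
Implicit Types (x y z p d : H) (a : R).

Lemma dotC x y : dot x y = dot y x.
Proof. by rewrite hermC expr0 mul1r. Qed.

Lemma dotDl x y z : dot (x + y) z = dot x z + dot y z.
Proof. exact: linearDl. Qed.

Lemma dotDr x y z : dot x (y + z) = dot x y + dot x z.
Proof. exact: linearDr. Qed.

Lemma dotBl x y z : dot (x - y) z = dot x z - dot y z.
Proof. exact: linearBl. Qed.

Lemma dotZr a x y : dot x (a *: y) = a * dot x y.
Proof. exact: linearZ. Qed.

Lemma dotZl a x y : dot (a *: x) y = a * dot x y.
Proof. by rewrite dotC dotZr dotC. Qed.

Lemma dotxx x : dot x x = `|x| ^+ 2.
Proof.
rewrite hdot sqr_sqrtr//; have [->|x0] := eqVneq x 0.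
  by rewrite linear0l.
exact/ltW/neq0_dnorm_gt0.
Qed.

Lemma sqr_normD x y : `|x + y| ^+ 2 = `|x| ^+ 2 + 2 * dot x y + `|y| ^+ 2.
Proof. by rewrite -!dotxx dotDl !dotDr (dotC y x); ring. Qed.

Lemma sqr_normZ a x : `|a *: x| ^+ 2 = a ^+ 2 * `|x| ^+ 2.
Proof. by rewrite -!dotxx dotZl dotZr; ring. Qed.

Variables (f : H -> R) (gradf : H -> H).
Hypothesis f_convex : convex_function [set: H] f.
Hypothesis f_grad : is_gradient dot f gradf.
Hypothesis gradf_lip : 1.-lipschitz gradf.

(** The difference quotients of [f] along a line, in the parameter [r], are
    those that define the directional derivative. *)
Lemma is_derive_line x d (s : R) :
  is_derive s (1 : R) (fun r : R => f (x + r *: d))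
    (dot (gradf (x + s *: d)) d).
Proof.
have [df dfE] := f_grad (x + s *: d).
have quotE : (fun h : R => h^-1 *: (f (x + (h *: 1 + s) *: d) - f (x + s *: d)))
    = (fun h : R => h^-1 *: (f (h *: d + (x + s *: d)) - f (x + s *: d))).
  apply/funext => h; congr (_ *: (f _ - _)).
  by rewrite -[h *: 1]/(h * 1) mulr1 scalerDl addrCA.
apply: DeriveDef.
  by rewrite /derivable /= quotE; exact: diff_derivable.
by rewrite /derive /= quotE -dfE -deriveE.
Qed.

Lemma dot_gradB_le x d (s : R) : 0 <= s ->
  dot (gradf (x + s *: d) - gradf x) d <= s * `|d| ^+ 2.
Proof.
rewrite le_eqVlt => /predU1P[<-|s0].
  by rewrite scale0r addr0 subrr mul0r linear0l.
set a := gradf _ - _.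
have alip : `|a| ^+ 2 <= s ^+ 2 * `|d| ^+ 2.
  have /= := @gradf_lip (x + s *: d, x) (conj I I); rewrite mul1r.
  rewrite [X in _ <= `|X|](_ : _ = s *: d); last by rewrite addrAC subrr add0r.
  by rewrite -/a -sqr_normZ => ?; rewrite lerXn2r ?nnegrE.
(* the square of [a - s *: d] replaces the Cauchy-Schwarz inequality *)
have : 0 <= `|a + (- s) *: d| ^+ 2 by rewrite sqr_ge0.
rewrite sqr_normD sqr_normZ dotZr sqrrN => a0.
rewrite -(ler_pM2l s0); nra.
Qed.

Lemma convex_comb_le (s : R) x y : 0 <= s <= 1 ->
  f (s *: x + (1 - s) *: y) <= s * f x + (1 - s) * f y.
Proof.
by move=> /andP[s0 s1]; apply: (f_convex (Itv01 s0 s1)); rewrite inE.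
Qed.

(** The remainder of the first order expansion along the segment from [x] to
    [x + d], minus its quadratic bound, has a nonpositive derivative. *)
Lemma descent x d : f (x + d) <= f x + dot (gradf x) d + 2^-1 * `|d| ^+ 2.
Proof.
pose phi (s : R) :=
  f (x + s *: d) - (s * dot (gradf x) d + 2^-1 * `|d| ^+ 2 * s ^+ 2).
have dphi (s : R) : is_derive s (1 : R) phi
    (dot (gradf (x + s *: d) - gradf x) d - s * `|d| ^+ 2).
  have ? := is_derive_line x d s.
  by apply: is_derive_eq; rewrite /GRing.scale/= dotBl; field.
have : phi 1 <= phi 0.
  have dphi1 (r : R) : derivable phi r 1 by case: (dphi r).
  apply: (@ler0_derive1_le_cc _ phi 0 1) => //;
    rewrite ?in_itv/= ?lexx ?ler01//.
  - move=> r; rewrite in_itv/= => /andP[r0 _].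
    rewrite derive1E (derive_val (is_derive := dphi r)) subr_le0.
    by rewrite dot_gradB_le// ltW.
  - by apply: derivable_within_continuous => r _.
rewrite /phi scale1r scale0r addr0 mul1r mul0r expr1n expr0n/= mulr0 mulr1; lra.
Qed.

(** Convexity is used on the segment from [x + d] to a point [x - s d] slightly
    beyond [x], where [descent] bounds [f] from above; then [s] tends to 0. *)
Lemma convex_gradient_le x d : f x + dot (gradf x) d <= f (x + d).
Proof.
apply: (@le_of_small_steps _ _ _ (2^-1 * `|d| ^+ 2)) => s /andP[s0 _].
have s1 : 0 < 1 + s by rewrite addr_gt0.
have th : 0 <= s / (1 + s) <= 1.
  by rewrite divr_ge0 ?(ltW s0) ?(ltW s1)// ler_pdivrMr// mul1r lerDr ler01.
have := convex_comb_le (x + d) (x + (- s) *: d) th.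
have -> : (s / (1 + s)) *: (x + d) + (1 - s / (1 + s)) *: (x + - s *: d) = x.
  rewrite !scalerDr !scalerA addrACA -!scalerDl.
  rewrite [X in X *: x](_ : _ = 1) ?scale1r; last by field; rewrite gt_eqF.
  rewrite [X in X *: d](_ : _ = 0) ?scale0r ?addr0//.
  by field; rewrite gt_eqF.
have := descent x ((- s) *: d).
rewrite sqr_normZ dotZr sqrrN.
move=> desc; rewrite -(ler_pM2r s1) => cvx.
have {cvx} : f x * (1 + s) <= s * f (x + d) + f (x + - s *: d).
  move/le_trans: cvx; apply; rewrite le_eqVlt; apply/orP; left; apply/eqP.
  by field; rewrite gt_eqF.
move=> cvx; rewrite -(ler_pM2l s0); nra.
Qed.

Variable g : H -> \bar R.
Hypothesis g_proper : proper_efunction g.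
Hypothesis g_convex : convex_efunction g.

(** Where [g] is infinite [fine] returns 0: the value is the energy only at
    points of the domain of [g]. *)
Definition energyR x : R := f x + fine (g x).

Lemma convex_energyR (s : R) x y : 0 <= s <= 1 ->
  g x \is a fin_num -> g y \is a fin_num ->
  g (s *: x + (1 - s) *: y) \is a fin_num /\
  energyR (s *: x + (1 - s) *: y) <= s * energyR x + (1 - s) * energyR y.
Proof.
move=> s01 gx gy; have := convex_efunction_comb x y g_convex s01.
rewrite -(fineK gx) -(fineK gy) -!EFinM -EFinD => gz.
have zfin : g (s *: x + (1 - s) *: y) \is a fin_num.
  by rewrite fin_numE g_proper.1/= -ltey (le_lt_trans gz)// ltry.
split => //; move: gz; rewrite -{1}(fineK zfin) lee_fin.
have := convex_comb_le x y s01; rewrite /energyR; lra.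
Qed.

Lemma argmin_fin_num (A : set H) c p y :
  (exists2 x, A x & (g x < +oo)%E) ->
  is_argmin A (fun x => (2^-1 * `|x - c + p| ^+ 2)%:E + g x)%E y ->
  g y \is a fin_num.
Proof.
move=> [x Ax gx] [_ /(_ _ Ax) yx].
rewrite fin_numE g_proper.1/=; apply: contraTneq yx => ->.
by rewrite addey// -ltNge lte_add_pinfty// ltry.
Qed.

(** First order optimality: the minimiser [y] is compared with the points of
    the segment from [y] to [z], which stays in [A], close to [y]. *)
Lemma argmin_variational (A : set H) c p y z : convex_set A ->
  is_argmin A (fun x => (2^-1 * `|x - c + p| ^+ 2)%:E + g x)%E y -> A z ->
  g y \is a fin_num -> g z \is a fin_num ->
  fine (g y) <= fine (g z) + dot (y - c + p) (z - y).
Proof.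
move=> cA [Ay ymin] Az gy gz.
apply: (@le_of_small_steps _ _ _ (2^-1 * `|z - y| ^+ 2)) => s /andP[s0 s1].
have s01 : 0 <= s <= 1 by rewrite (ltW s0).
have /ymin := convex_set_comb cA s01 Az Ay.
have := convex_efunction_comb z y g_convex s01.
have -> : s *: z + (1 - s) *: y - c + p = (y - c + p) + s *: (z - y).
  rewrite scalerBl scale1r scalerBr addrCA.
  by rewrite (addrAC y) (addrAC (y - c)).
rewrite -(fineK gy) -(fineK gz) -!EFinM -EFinD => gs.
move=> /le_trans/(_ (leeD2l _ gs)); rewrite -!EFinD lee_fin.
rewrite (sqr_normD _ (s *: _)) sqr_normZ dotZr => cmp.
rewrite -(ler_pM2l s0); nra.
Qed.

(** The linear terms in [gradf c] cancel between the descent estimate for the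
    step from [c] to [y], the convexity estimate for [z] and the optimality
    of [y]. *)
Lemma prox_gradient_le (A : set H) c y z : convex_set A ->
  is_argmin A (fun x => (2^-1 * `|x - c + gradf c| ^+ 2)%:E + g x)%E y ->
  A z -> g y \is a fin_num -> g z \is a fin_num ->
  energyR y + 2^-1 * `|z - y| ^+ 2 <= energyR z + 2^-1 * `|z - c| ^+ 2.
Proof.
move=> cA ymin Az gy gz; have := argmin_variational cA ymin Az gy gz.
have cK x : c + (x - c) = x by rewrite addrC subrK.
have := descent c (y - c); have := convex_gradient_le c (z - c); rewrite !cK.
have -> : z - c = (y - c) + (z - y) by rewrite [RHS]addrC addrA subrK.
rewrite /energyR (sqr_normD _ (z - y)) dotDl dotDr; lra.
Qed.

(** Comparing with the convex combination of [x] and the previous iterate that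
    has weight [1 / tau] on [x] turns the two distances of [prox_gradient_le]
    into distances from [x] to consecutive momentum points [v] and [v']. *)
Lemma fista_step (A : set H) (tau : R) (u v x y : H) : convex_set A ->
  1 <= tau -> A u -> A x ->
  g u \is a fin_num -> g x \is a fin_num -> g y \is a fin_num ->
  let c := (1 - tau^-1) *: u + tau^-1 *: v in
  let v' := (1 - tau) *: u + tau *: y in
  is_argmin A (fun x => (2^-1 * `|x - c + gradf c| ^+ 2)%:E + g x)%E y ->
  tau ^+ 2 * energyR y + 2^-1 * `|v' - x| ^+ 2
    <= (tau ^+ 2 - tau) * energyR u + tau * energyR x + 2^-1 * `|v - x| ^+ 2.
Proof.
move=> cA tau1 Au Ax gu gx gy c v' ymin.
have tau0 : 0 < tau by rewrite (lt_le_trans ltr01).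
have s01 : 0 <= tau^-1 <= 1 by rewrite invr_ge0 ltW//= invf_le1.
pose z := tau^-1 *: x + (1 - tau^-1) *: u.
have [gz zle] := convex_energyR s01 gx gu.
have := prox_gradient_le cA ymin (convex_set_comb cA s01 Ax Au) gy gz.
have -> : tau^-1 *: x + (1 - tau^-1) *: u - y = tau^-1 *: (x - v').
  rewrite scalerBr scalerDr !scalerA mulVf ?gt_eqF// scale1r mulrBr mulr1.
  rewrite mulVf ?gt_eqF// opprD addrA; congr (_ + _ - _).
  by rewrite -scaleNr opprB.
have -> : tau^-1 *: x + (1 - tau^-1) *: u - c = tau^-1 *: (x - v).
  by rewrite opprD addrA addrK scalerBr.
rewrite !sqr_normZ (distrC x v') (distrC x v) => step.
have : tau ^+ 2 * (energyR y + 2^-1 * (tau^-1 ^+ 2 * `|v' - x| ^+ 2)) <=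
   tau ^+ 2 * (tau^-1 * energyR x + (1 - tau^-1) * energyR u +
   2^-1 * (tau^-1 ^+ 2 * `|v - x| ^+ 2)).
  rewrite ler_pM2l ?exprn_gt0//; apply: le_trans step _.
  by rewrite lerD2r.
rewrite [X in X <= _ -> _](_ : _ =
  tau ^+ 2 * energyR y + 2^-1 * `|v' - x| ^+ 2); last by field; rewrite gt_eqF.
rewrite [X in _ <= X -> _](_ : _ = (tau ^+ 2 - tau) * energyR u +
  tau * energyR x + 2^-1 * `|v - x| ^+ 2) //; by field; rewrite gt_eqF.
Qed.
End Hilbert.

(** * Restarting the Lyapunov function at each new comparison point *)

Lemma le_of_steps {R : realType} (L : nat -> R) (c : R) (a N : nat) :
  0 <= c -> (forall n, (a <= n < N)%N -> L n.+1 <= L n + c) -> (a <= N)%N ->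
  L N <= L a + N%:R * c.
Proof.
move=> c0; elim: N => [|N IH] step.
  by rewrite leqn0 => /eqP->; rewrite mul0r addr0.
rewrite leq_eqVlt => /predU1P[->|]; first by rewrite lerDl mulr_ge0.
rewrite ltnS => aN; have LN : L N <= L a + N%:R * c.
  by apply: IH => // n /andP[an nN]; rewrite step// an ltnW.
have aNS : (a <= N < N.+1)%N by rewrite aN ltnSn.
by have := step _ aNS; rewrite -natr1; lra.
Qed.

Section Restart.
Context {R : realType} {H : normedModType R}.
Variables (t e : nat -> R) (v : nat -> H).
Hypothesis e_ge0 : forall n, (0 < n)%N -> 0 <= e n.

Definition lyapunov (n : nat) (x : H) : R :=
  t n ^+ 2 * e n + 2^-1 * `|v n - x| ^+ 2.

Lemma weighted_gap_ge0 n : (0 < n)%N -> 0 <= t n ^+ 2 * e n.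
Proof. by move=> n0; rewrite mulr_ge0 ?sqr_ge0 ?e_ge0. Qed.

Lemma lyapunov_gap n x : t n ^+ 2 * e n <= lyapunov n x.
Proof. by rewrite lerDl mulr_ge0 ?sqr_ge0. Qed.

Lemma lyapunov_ge0 n x : (0 < n)%N -> 0 <= lyapunov n x.
Proof. by move=> /weighted_gap_ge0/le_trans; apply; exact: lyapunov_gap. Qed.

(** The square root of the Lyapunov function behaves like a norm in [v n - x],
    hence moves by at most the distance between the two centres. *)
Lemma lyapunov_recentre n x y (M : R) : (0 < n)%N -> 0 <= M ->
  lyapunov n x <= M ^+ 2 -> lyapunov n y <= (M + `|x - y|) ^+ 2.
Proof.
rewrite /lyapunov => /weighted_gap_ge0; set A := t n ^+ 2 * e n => A0 M0 LM.
have d0 : 0 <= `|v n - x| by [].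
have D0 : 0 <= `|x - y| by [].
have tri : `|v n - y| <= `|v n - x| + `|x - y|.
  by rewrite (le_trans _ (ler_normD _ _))// addrA subrK.
have d2M : `|v n - x| <= 2 * M.
  have : `|v n - x| ^+ 2 <= (2 * M) ^+ 2 by rewrite exprMn; nra.
  by rewrite ler_pXn2r ?nnegrE ?mulr_ge0.
have : `|v n - y| ^+ 2 <= (`|v n - x| + `|x - y|) ^+ 2.
  by rewrite lerXn2r ?nnegrE ?addr_ge0.
have := ler_wpM2r D0 d2M.
have := sqr_ge0 `|x - y|.
nra.
Qed.

Variables (nk : nat -> nat) (w : nat -> H) (cost : nat -> R) (k0 : nat).
Hypothesis nk_homo : {homo nk : i j / (i < j)%N}.
Hypothesis nk_gt1 : (1 < nk k0)%N.
(* The block starts from the state reached just before the first iteration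
   into a set that is known to contain [w k], whence the predecessor. *)
Hypothesis block_cost : forall k N,
  (k0 <= k)%N -> (nk k <= N.+1 < (nk k.+1).+1)%N ->
  lyapunov N (w k) <= lyapunov (nk k).-1 (w k) + cost k.

Lemma block_start_gt0 k : (k0 <= k)%N -> (0 < (nk k).-1)%N.
Proof.
have nk_le : {homo nk : i j / (i <= j)%N} := ltnW_homo nk_homo.
by move=> /nk_le /(leq_trans nk_gt1); case: (nk k) => [|[|n]].
Qed.

(** Adding the cost of a block to the square of [p k] and the move of the
    centre to [q k] is what keeps costs that are merely summable, and not of
    summable square roots, under control: [(p + q) ^+ 2 + c] is at most
    [(p' + q) ^+ 2] as soon as [p ^+ 2 + c] is at most [p' ^+ 2]. *)
Lemma restart_majorant (p q : nat -> R) :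
  (forall k, 0 <= p k) -> (forall k, 0 <= q k) -> (forall k, 0 <= cost k) ->
  (forall k, (k0 <= k)%N -> p k ^+ 2 + cost k <= p k.+1 ^+ 2) ->
  (forall k, (k0 <= k)%N -> q k + `|w k - w k.+1| <= q k.+1) ->
  lyapunov (nk k0).-1 (w k0) <= (p k0 + q k0) ^+ 2 ->
  forall k N, (k0 <= k)%N -> (nk k <= N < nk k.+1)%N ->
    t N ^+ 2 * e N <= (p k.+1 + q k.+1) ^+ 2.
Proof.
move=> p0 q0 c0 pS qS init.
have in_block k N : (k0 <= k)%N ->
    lyapunov (nk k).-1 (w k) <= (p k + q k) ^+ 2 ->
    (nk k <= N.+1 < (nk k.+1).+1)%N ->
    lyapunov N (w k) <= (p k.+1 + q k) ^+ 2.
  move=> k0k start kN; apply: le_trans (block_cost k0k kN) _.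
  have pp : p k <= p k.+1.
    by rewrite -(@ler_pXn2r _ 2)// ?nnegrE// (le_trans _ (pS _ k0k))// lerDl.
  have := ler_wpM2r (q0 k) pp; have := pS _ k0k; nra.
have start k : (k0 <= k)%N -> lyapunov (nk k).-1 (w k) <= (p k + q k) ^+ 2.
  elim: k => [|k IH].
    by move: init; rewrite leqn0 => + /eqP k00; rewrite k00.
  rewrite leq_eqVlt => /predU1P[<-//|]; rewrite ltnS => k0k.
  have k0kS := leqW k0k.
  have nkS : (0 < nk k.+1)%N.
    by have := block_start_gt0 k0kS; case: (nk k.+1).
  have inb : (nk k <= (nk k.+1).-1.+1 < (nk k.+1).+1)%N.
    by rewrite prednK// ltnSn andbT ltnW// nk_homo.
  have := in_block _ _ k0k (IH k0k) inb.
  move=> /(lyapunov_recentre (w k.+1) (block_start_gt0 k0kS)).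
  move=> /(_ (addr_ge0 (p0 _) (q0 _)))/le_trans; apply.
  rewrite ler_pXn2r ?nnegrE ?addr_ge0//.
  by rewrite -addrA lerD2l qS.
move=> k N k0k /andP[kN Nk].
apply: le_trans (lyapunov_gap N (w k)) _.
have kNb : (nk k <= N.+1 < (nk k.+1).+1)%N by rewrite (leqW kN) ltnS.
apply: le_trans (in_block _ _ k0k (start _ k0k) kNb) _.
rewrite ler_pXn2r ?nnegrE ?addr_ge0// lerD2l.
by rewrite (le_trans _ (qS _ k0k))// lerDl.
Qed.

(** [restart_majorant] with [p k] the square root of the initial value of the
    Lyapunov function plus [P k]. *)
Lemma restart_bounded (P Q : nat -> R) (SP SQ : R) :
  (forall k, 0 <= P k) -> (forall k, 0 <= Q k) -> (forall k, 0 <= cost k) ->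
  (forall k, (k0 <= k)%N -> P k + cost k <= P k.+1) ->
  (forall k, (k0 <= k)%N -> Q k + `|w k - w k.+1| <= Q k.+1) ->
  (forall k, P k <= SP) -> (forall k, Q k <= SQ) ->
  exists B, forall k N, (k0 <= k)%N -> (nk k <= N < nk k.+1)%N ->
    t N ^+ 2 * e N <= B.
Proof.
move=> P0 Q0 c0 PS QS PSP QSQ.
have L0 := lyapunov_ge0 (w k0) (block_start_gt0 (leqnn k0)).
set L := lyapunov _ _ in L0.
pose p k := Num.sqrt (L + P k).
have LP0 k : 0 <= L + P k by rewrite addr_ge0.
have psqr k : p k ^+ 2 = L + P k by rewrite sqr_sqrtr.
have SQ0 : 0 <= SQ := le_trans (Q0 0%N) (QSQ 0%N).
exists ((Num.sqrt (L + SP) + SQ) ^+ 2) => k N k0k kN.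
have p0 j : 0 <= p j by exact: sqrtr_ge0.
apply: le_trans (restart_majorant p0 Q0 c0 _ QS _ k0k kN) _.
- by move=> j /PS; rewrite !psqr -addrA lerD2l.
- rewrite -/L; have := psqr k0; have := P0 k0; have := Q0 k0; have := p0 k0.
  by move: (p k0) (P k0) (Q k0) => x y z *; nra.
rewrite ler_pXn2r ?nnegrE ?addr_ge0 ?sqrtr_ge0//.
by rewrite lerD// ler_sqrt ?lerD2l// (le_trans (LP0 k.+1))// lerD2l.
Qed.

(** [restart_majorant] with [p] and [q] both equal to the same multiple of
    the powers of [a]. *)
Lemma restart_geometric (a C : R) : 1 < a -> 0 <= C ->
  (forall k, 0 <= cost k) ->
  (forall k, (k0 <= k)%N -> cost k <= C * a ^+ (2 * k)) ->
  (forall k, (k0 <= k)%N -> `|w k - w k.+1| <= C * a ^+ k) ->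
  exists2 B, 0 <= B & forall k N, (k0 <= k)%N -> (nk k <= N < nk k.+1)%N ->
    t N ^+ 2 * e N <= B * a ^+ (2 * k).
Proof.
move=> a1 C0 c0 costC moveC.
have a0 : 0 < a := lt_trans ltr01 a1.
have L0 := lyapunov_ge0 (w k0) (block_start_gt0 (leqnn k0)).
set L := lyapunov _ _ in L0.
(* [L] covers the initial value and [C / (a - 1)] the increments; 1 makes
   [P ^+ 2] at least [P] *)
pose P := 1 + L + C / (a - 1).
have am1 : 0 < a - 1 by rewrite subr_gt0.
have Ca0 : 0 <= C / (a - 1) by rewrite divr_ge0// ltW.
have P1 : 1 <= P by rewrite /P -addrA lerDl addr_ge0.
have PC : C <= P * (a - 1).
  by rewrite -ler_pdivrMr// /P lerDr addr_ge0.
have PL : L <= P by rewrite /P -addrA addrCA lerDl addr_ge0.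
have ak k : 0 < a ^+ k by exact: exprn_gt0.
pose p k := P * a ^+ k.
have p0 k : 0 <= p k by rewrite mulr_ge0 ?ltW// (lt_le_trans ltr01).
exists ((2 * P * a) ^+ 2) => [|k N k0k kN]; first exact: sqr_ge0.
apply: le_trans (restart_majorant p0 p0 c0 _ _ _ k0k kN) _.
- move=> j /costC /(lerD (lexx _)) /le_trans; apply.
  rewrite /p (exprS a) mulnC exprM.
  have := ak j; move: (a ^+ j) => x x0.
  have Cle : C <= P ^+ 2 * (a ^+ 2 - 1) by nra.
  have := ler_wpM2r (sqr_ge0 x) Cle; nra.
- move=> j /moveC /(lerD (lexx _)) /le_trans; apply.
  rewrite /p (exprS a); have := ler_wpM2r (ltW (ak j)) PC.
  by move: (a ^+ j) => x; lra.
- rewrite -/L (le_trans PL)// /p.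
  have : 1 <= a ^+ k0 by rewrite exprn_ege1// ltW.
  move: (a ^+ k0) => x x1; have : P * 1 <= P * x by rewrite ler_pM2l//; lra.
  nra.
rewrite /p (exprS a) mulnC exprM -exprMn.
by rewrite le_eqVlt; apply/orP; left; apply/eqP; ring.
Qed.

End Restart.

(** * Asymptotic comparisons *)

Section Comparisons.
Context {R : realType}.

Lemma lesssim_EFin (a : nat -> \bar R) (b : nat -> R) :
  lesssim a (fun n => (b n)%:E) ->
  exists C, exists2 N, 0 < C & forall n, (N < n)%N -> (a n <= (C * b n)%:E)%E.
Proof. by move=> [C [N [C0 _ ab]]]; exists C, N => // n /ab; rewrite EFinM. Qed.

(** Finitely many terms are absorbed in the constant. *)
Lemma lesssim_uniformly_EFin (r b : nat -> R) (C : R) N1 :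
  (forall n, (0 < n)%N -> 0 < b n) ->
  (forall n, (N1 <= n)%N -> r n <= C * b n) ->
  lesssim_uniformly (fun n => (r n)%:E) (fun n => (b n)%:E).
Proof.
move=> b0 rb; pose S := \sum_(i < N1) `|r i / b i|.
have S0 : 0 <= S by exact: sumr_ge0.
exists (`|C| + 1 + S) => [|n n0].
  by rewrite ltr_wpDr// ltr_wpDl.
rewrite -EFinM lee_fin; have [/rb/le_trans|nN1] := leqP N1 n.
  apply; rewrite ler_wpM2r//; first exact/ltW/b0.
  by rewrite (le_trans (ler_norm C))// -addrA lerDl addr_ge0.
rewrite -ler_pdivrMr ?b0// (le_trans (ler_norm _))//.
rewrite (@le_trans _ _ S)//.
  rewrite /S (bigD1 (Ordinal nN1))//= lerDl; exact: sumr_ge0.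
by rewrite lerDr addr_ge0.
Qed.

Lemma partial_sums_bounded (a : nat -> R) : (forall n, 0 <= a n) ->
  (\sum_(1 <= k <oo) (a k)%:E < +oo)%E ->
  exists S, forall n, \sum_(1 <= k < n) a k <= S.
Proof.
move=> a0 aoo; have ae0 n : (1 <= n)%N -> true -> (0 <= (a n)%:E)%E.
  by rewrite lee_fin.
have sfin : (\sum_(1 <= k <oo) (a k)%:E)%E \is a fin_num.
  rewrite ge0_fin_numE//; exact: nneseries_ge0.
exists (fine (\sum_(1 <= k <oo) (a k)%:E)%E) => n.
rewrite -lee_fin fineK// -sumEFin; exact: nneseries_lim_ge.
Qed.

Lemma leq_strictly_increasing (nk : nat -> nat) :
  {homo nk : i j / (i < j)%N} -> forall k, (k <= nk k)%N.
Proof. by move=> h; elim=> // k IH; rewrite (leq_ltn_trans IH)// h. Qed.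

Lemma block_of (nk : nat -> nat) k0 N : {homo nk : i j / (i < j)%N} ->
  (nk k0 <= N)%N -> exists2 k, (k0 <= k)%N & (nk k <= N < nk k.+1)%N.
Proof.
move=> h; elim: N => [|N IH] k0N.
  by exists k0 => //; rewrite k0N (leq_ltn_trans (leq0n (nk k0)))// h.
move: k0N; rewrite leq_eqVlt => /predU1P[k0N|].
  by exists k0 => //; rewrite k0N leqnn -k0N h.
rewrite ltnS => /IH[k k0k /andP[kN]].
rewrite leq_eqVlt => /predU1P[kS|Nk]; last first.
  by exists k => //; rewrite (leqW kN).
by exists k.+1; [exact: leqW | rewrite kS leqnn h].
Qed.

(** [kappa] is the exponent with [(aE * aU ^+ 2) `^ kappa = aU ^+ 2]. *)
Lemma le_kappa_power (aU aE C x : R) k :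
  let kappa := ln (aU ^+ 2) / (ln aE + ln (aU ^+ 2)) in
  1 < aU -> 1 <= aE -> 0 < C -> 0 < x ->
  aE ^+ k * aU ^+ (2 * k) <= C * x ^+ 2 ->
  aU ^+ (2 * k) <= C `^ kappa * x `^ (2 * kappa).
Proof.
move=> kappa aU1 aE1 C0 x0; set b := aE * aU ^+ 2.
have aE0 : 0 < aE := lt_le_trans ltr01 aE1.
have aU0 : 0 < aU ^+ 2 by rewrite exprn_gt0// (lt_trans ltr01).
have lnU : 0 < ln (aU ^+ 2) by rewrite ln_gt0// exprn_egt1.
have lnE : 0 <= ln aE by exact: ln_ge0.
have den0 : 0 < ln aE + ln (aU ^+ 2) by rewrite ltr_wpDl.
have b0 : 0 < b by rewrite mulr_gt0.
have kappa0 : 0 <= kappa by rewrite divr_ge0 ?ltW.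
have bkappa : b `^ kappa = aU ^+ 2.
  by rewrite /powR gt_eqF// lnM// divfK ?gt_eqF// lnK.
rewrite exprM -exprMn -/b => bC.
have bk0 : b ^+ k \is Num.nneg by rewrite nnegrE exprn_ge0// ltW.
have Cx0 : C * x ^+ 2 \is Num.nneg by rewrite nnegrE mulr_ge0 ?sqr_ge0// ltW.
have := ge0_ler_powR kappa0 bk0 Cx0 bC.
rewrite powRM ?sqr_ge0 ?(ltW C0)// -(powR_mulrn k (ltW b0)) powRAC bkappa.
rewrite powR_mulrn ?(ltW aU0)// => /le_trans; apply.
by rewrite -(powR_mulrn 2 (ltW x0)) -powRrM.
Qed.

End Comparisons.

(** * The refining algorithm *)

Section Energy.
Context {R : realType} {H : completeNormedModType R}.
Variables (f : H -> R) (g : H -> \bar R).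
Hypothesis g_proper : proper_efunction g.
Hypothesis E_bounded : bounded_below (energy f g).

Definition inf_energy : R := fine (ereal_inf (range (energy f g))).

Lemma ereal_inf_energy_fin_num :
  ereal_inf (range (energy f g)) \is a fin_num.
Proof.
have [m Em] := E_bounded; have [_ [x gx]] := g_proper.
rewrite fin_numElt; apply/andP; split.
  rewrite (@lt_le_trans _ _ m%:E) ?ltNyr//.
  by apply/ereal_infP => _ [y _ <-].
rewrite (@le_lt_trans _ _ (energy f g x))//.
  by apply: ereal_inf_lbound; exists x.
by rewrite lte_add_pinfty ?ltry.
Qed.

Lemma energy_gapE x : g x \is a fin_num ->
  energy_gap f g x = (energyR f g x - inf_energy)%:E.
Proof.
move=> gx.
by rewrite EFinB EFinD !fineK// ereal_inf_energy_fin_num.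
Qed.

Lemma inf_energy_le x : g x \is a fin_num -> inf_energy <= energyR f g x.
Proof.
move=> gx; rewrite -lee_fin fineK ?ereal_inf_energy_fin_num//.
by rewrite EFinD (fineK gx); apply: ereal_inf_lbound; exists x.
Qed.

Lemma energy_gap_fin_num x (c : R) : (energy_gap f g x <= c%:E)%E ->
  g x \is a fin_num.
Proof.
move=> xc; rewrite fin_numE g_proper.1/=; apply: contraTneq xc => gx.
rewrite /energy_gap /energy gx addey// -(fineK ereal_inf_energy_fin_num).
by rewrite -EFinN addye// -ltNge ltry.
Qed.

End Energy.

(** One iteration of the algorithm decreases the Lyapunov function centred at
    any [x] of the new set, up to the excess energy of [x]; the condition on
    the stepsizes is what turns [t n.+1 ^+ 2 - t n.+1] into [t n ^+ 2]. *)
Lemma refining_fista_step {R : realType} {H : completeNormedModType R}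
  (dot : {dot H for (@idfun R)}) (f : H -> R) (gradf : H -> H)
  (g : H -> \bar R) (U : nat -> set H) (t : nat -> R) (u v : nat -> H) n x :
  induces_norm dot -> convex_function [set: H] f -> is_gradient dot f gradf ->
  1.-lipschitz gradf -> proper_efunction g -> convex_efunction g ->
  bounded_below (energy f g) -> (forall n, convex_set (U n)) ->
  fista_stepsize t -> refining_fista gradf g U t u v ->
  (0 < n)%N -> U n.+1 (u n) -> U n.+1 x ->
  g (u n) \is a fin_num -> g (u n.+1) \is a fin_num -> g x \is a fin_num ->
  let e i := energyR f g (u i) - inf_energy f g in
  lyapunov t e v n.+1 x
    <= lyapunov t e v n x + t n.+1 * (energyR f g x - inf_energy f g).
Proof.
move=> hdot fcvx fgrad flip gprop gcvx Ebd Ucvx [_ ht] [_ _ alg].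
move=> n0 Uu Ux gu gu' gx.
have [t1 rho] := ht _ n0; have [t'1 _] := ht n.+1 isT.
have [umin vE] := alg n.
have := fista_step hdot fcvx fgrad flip gprop gcvx (Ucvx n.+1) t'1 Uu Ux
  gu gx gu' umin.
rewrite -vE /lyapunov; have := inf_energy_le gprop Ebd gu; rewrite -subr_ge0.
by move=> /(mulr_ge0 rho); lra.
Qed.

Theorem theorem2 (R : realType) (H : completeNormedModType R)
  (dot : {dot H for (@idfun R)}) (hdot : induces_norm dot)
  (f : H -> R) (gradf : H -> H) (g : H -> \bar R)
  (f_convex : convex_function [set: H] f)
  (f_grad : is_gradient dot f gradf)
  (gradf_lip : 1.-lipschitz gradf)
  (g_proper : proper_efunction g)
  (g_convex : convex_efunction g)
  (g_wlsc : weakly_lower_semicontinuous dot g)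
  (E_bounded : bounded_below (energy f g))
  (aU aE : R) (haU : 1 <= aU) (haE : 1 <= aE)
  (w : nat -> H) (hw : minimising_sequence (energy_gap f g) aU aE w)
  (nk : nat -> nat) (hnk : {homo nk : i j / (i < j)%N})
  (U : nat -> set H)
  (U_closed : forall n, closed (U n))
  (U_convex : forall n, convex_set (U n))
  (U_dom : forall n, exists2 x, U n x & (g x < +oo)%E)
  (t : nat -> R) (ht : fista_stepsize t)
  (u v : nat -> H) (huv : refining_fista gradf g U t u v)
  (huU : forall n, U n.+1 (u n))
  (hwU : forall k j, (nk k <= j < nk k.+1)%N -> U j (w k))
  (ht_lin : simeq (fun n => (t n)%:E) (fun n => n%:R%:E))
  (hcases :
    (1 < aU /\
     simeq (fun k => ((nk k)%:R ^+ 2)%:E)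
           (fun k => (aE ^+ k * aU ^+ (2 * k))%:E))
    \/
    [/\ aU = 1,
        (\sum_(1 <= k <oo) ((nk k)%:R ^+ 2 * aE ^- k)%:E < +oo)%E &
        (\sum_(1 <= k <oo) `|w k - w k.+1|%:E < +oo)%E]) :
  let kappa := ln (aU ^+ 2) / (ln aE + ln (aU ^+ 2)) in
  lesssim_uniformly (fun N => energy_gap f g (u N))
    (fun N => ((N%:R `^ (2 * (1 - kappa)))^-1)%:E).
Proof.
move=> kappa; set m := inf_energy f g.
have [_ _ alg] := huv.
pose e n := energyR f g (u n) - m.
(* index 0 is excluded: nothing makes [g] finite at the initial point *)
have gu n : (0 < n)%N -> g (u n) \is a fin_num.
  case: n => // n _; have [umin _] := alg n.
  exact: argmin_fin_num g_proper _ _ _ _ (U_dom n.+1) umin.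
have eE n : (0 < n)%N -> energy_gap f g (u n) = (e n)%:E.
  by move=> /gu; exact: energy_gapE.
have e0 n : (0 < n)%N -> 0 <= e n.
  by move=> /gu gun; rewrite subr_ge0 inf_energy_le.
have [Cw [Nw Cw0 wC]] := lesssim_EFin hw.1.
have [Ce [Ne Ce0 eC]] := lesssim_EFin hw.2.
have [Ct [Nt Ct0 tC]] := lesssim_EFin ht_lin.1.
have [Cn [Nn Cn0 nC]] := lesssim_EFin ht_lin.2.
have aE0 : 0 < aE := lt_le_trans ltr01 haE.
have aU0 : 0 < aU := lt_le_trans ltr01 haU.
have kle := leq_strictly_increasing hnk.
pose cost k := Ct * Ce * ((nk k.+1)%:R ^+ 2 * aE ^- k).
have cost0 k : 0 <= cost k.
  by rewrite !mulr_ge0 ?invr_ge0 ?sqr_ge0// ltW// exprn_gt0.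
have block k N : ((Ne + Nt).+1 < k)%N -> (nk k <= N.+1 < (nk k.+1).+1)%N ->
    lyapunov t e v N (w k) <= lyapunov t e v (nk k).-1 (w k) + cost k.
  move=> kN /andP[kN1 kN2]; have knk := kle k.
  have gap := eC k ltac:(clear -kN; lia).
  have gw := energy_gap_fin_num g_proper E_bounded gap.
  move: gap; rewrite energy_gapE// lee_fin => gap.
  pose c := Ct * (nk k.+1)%:R * (Ce * aE ^- k).
  have c0 : 0 <= c.
    by rewrite !mulr_ge0 ?invr_ge0// ltW// exprn_gt0.
  have step n : ((nk k).-1 <= n < N)%N ->
      lyapunov t e v n.+1 (w k) <= lyapunov t e v n (w k) + c.
    move=> /andP[kn nN]; have n0 : (0 < n)%N by clear -kN knk kn; lia.
    have Uw : U n.+1 (w k) by apply: hwU; clear -kn nN kN2; lia.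
    have tn1 : 0 <= t n.+1 by rewrite (le_trans ler01)// (ht.2 n.+1 isT).1.
    have := refining_fista_step hdot f_convex f_grad gradf_lip g_proper
      g_convex E_bounded U_convex ht huv n0 (huU n) Uw (gu _ n0)
      (gu n.+1 isT) gw.
    move=> /le_trans; apply; rewrite lerD2l ler_pM ?subr_ge0 ?inf_energy_le//.
    have := tC n.+1 ltac:(clear -kN knk kn; lia).
    rewrite lee_fin => /le_trans; apply.
    by rewrite ler_pM2l// ler_nat; clear -nN kN2; lia.
  have kN3 : ((nk k).-1 <= N)%N by clear -kN1; lia.
  apply: le_trans (le_of_steps c0 step kN3) _; rewrite lerD2l.
  have -> : cost k = (nk k.+1)%:R * c by rewrite /cost /c; ring.
  by rewrite ler_wpM2r// ler_nat; clear -kN2; lia.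
(* in both cases only the weighted gap remains to be bounded, block by block,
   as [t N] is of order [N] *)
have final (B : R) k0 : (forall k N, (k0 <= k)%N -> (nk k <= N < nk k.+1)%N ->
    t N ^+ 2 * e N <= B * N%:R `^ (2 * kappa)) ->
  lesssim_uniformly (fun N => energy_gap f g (u N))
    (fun N => ((N%:R `^ (2 * (1 - kappa)))^-1)%:E).
  move=> tB; pose b N : R := (N%:R `^ (2 * (1 - kappa)))^-1.
  have [||C C0 CP] :=
    @lesssim_uniformly_EFin _ e b (Cn ^+ 2 * B) (nk k0 + Nn).+1.
  - by move=> n n0; rewrite invr_gt0 powR_gt0// ltr0n.
  - move=> N Nlarge; have N0 : 0 < N%:R :> R.
      by rewrite ltr0n; clear -Nlarge; lia.
    have [k k0k kN] := @block_of nk k0 N hnk ltac:(clear -Nlarge; lia).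
    have {}tB := tB _ _ k0k kN.
    have {}nC : N%:R <= Cn * t N.
      by have := nC N ltac:(clear -Nlarge; lia); rewrite lee_fin.
    rewrite ler_pdivlMr ?powR_gt0//.
    rewrite -(ler_pM2r (powR_gt0 (2 * kappa) N0)) -mulrA -powRD; last first.
      by rewrite (gt_eqF N0) implybT.
    have -> : 2 * (1 - kappa) + 2 * kappa = 2%:R by ring.
    rewrite (powR_mulrn 2 (ltW N0)).
    have NC : N%:R ^+ 2 <= (Cn * t N) ^+ 2.
      by rewrite lerXn2r ?nnegrE// (le_trans _ nC).
    have eN : 0 <= e N by apply: e0; clear -Nlarge; lia.
    rewrite mulrC; apply: le_trans (ler_wpM2r eN NC) _.
    by rewrite exprMn -[leLHS]mulrA -[leRHS]mulrA ler_pM2l ?exprn_gt0.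
  by exists C => // n n0; rewrite eE//; exact: CP.
case: hcases => [[aU1 [nkle nkge]]|[aUE sumnk sumw]].
  have [C1 [N1 C10 C1P]] := lesssim_EFin nkle.
  have [C2 [N2 C20 C2P]] := lesssim_EFin nkge.
  pose k0 := (Nw + Ne + Nt + N1 + N2).+2.
  have nk1 : (1 < nk k0)%N by rewrite (leq_trans _ (kle k0)).
  pose Cc := Ct * Ce * C1 * aE * aU ^+ 2; pose Cm := Cw * (1 + aU).
  have Cc0 : 0 <= Cc by rewrite !mulr_ge0 ?sqr_ge0// ltW.
  have Cm0 : 0 <= Cm by rewrite !mulr_ge0 ?addr_ge0// ltW.
  have aUk k : 0 < aU ^+ k by rewrite exprn_gt0.
  have aEk k : 0 < aE ^+ k by rewrite exprn_gt0.
  have [|||B B0 tB] := @restart_geometric _ _ t e v e0 nk w cost k0 hnk nk1 _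
    aU (Cc + Cm) aU1 (addr_ge0 Cc0 Cm0) cost0.
  - by move=> k N k0k; apply: block; rewrite /k0 in k0k; clear -k0k; lia.
  - move=> k k0k; have := C1P k.+1 ltac:(rewrite /k0 in k0k; clear -k0k; lia).
    rewrite lee_fin => nkC.
    apply: (@le_trans _ _ (Cc * aU ^+ (2 * k))); last first.
      by rewrite ler_wpM2r ?(ltW (aUk _))// lerDl.
    apply: (@le_trans _ _ (Ct * Ce *
      (C1 * (aE ^+ k.+1 * aU ^+ (2 * k.+1)) * aE ^- k))).
      by rewrite ler_pM2l ?mulr_gt0// ler_pM2r ?invr_gt0.
    rewrite le_eqVlt; apply/orP; left; apply/eqP.
    rewrite /Cc mulnS exprD exprS; field; exact: lt0r_neq0.
  - move=> k k0k.
    have := wC k ltac:(rewrite /k0 in k0k; clear -k0k; lia).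
    have := wC k.+1 ltac:(rewrite /k0 in k0k; clear -k0k; lia).
    rewrite !lee_fin exprS => wkS wk; apply: le_trans (ler_normB _ _) _.
    have := mulr_ge0 Cc0 (ltW (aUk k)); rewrite /Cm; lra.
  apply: (final (B * (C2 `^ kappa)) k0) => k N k0k kN.
  apply: le_trans (tB _ _ k0k kN) _.
  have nkN : 0 < (nk k)%:R :> R.
    by rewrite ltr0n (leq_trans _ (kle k))// (leq_trans _ k0k).
  have := C2P k ltac:(rewrite /k0 in k0k; clear -k0k; lia); rewrite lee_fin.
  move=> /(le_kappa_power aU1 haE C20 nkN); rewrite -/kappa => aUN.
  rewrite -mulrA ler_wpM2l// (le_trans aUN)// ler_wpM2l ?powR_ge0//.
  have kappa_ge0 : 0 <= kappa.
    have lnU : 0 <= ln (aU ^+ 2) by rewrite ln_ge0// exprn_ege1.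
    by rewrite divr_ge0// addr_ge0// ln_ge0.
  apply: ge0_ler_powR; rewrite ?nnegrE ?ler_nat//; first exact: mulr_ge0.
  by case/andP: kN.
have kappa0 : kappa = 0 by rewrite /kappa aUE expr1n ln1 mul0r.
pose k0 := (Ne + Nt).+2.
have nk1 : (1 < nk k0)%N by rewrite (leq_trans _ (kle k0)).
have a0 k : 0 <= (nk k)%:R ^+ 2 * aE ^- k :> R.
  by rewrite mulr_ge0 ?sqr_ge0// invr_ge0 ltW// exprn_gt0.
have [S1 S1P] := partial_sums_bounded a0 sumnk.
have [S2 S2P] := partial_sums_bounded (fun k => normr_ge0 (w k - w k.+1)) sumw.
(* the cost of a block involves the end [nk k.+1] of the block, hence a sum up
   to [k] included *)
pose P k : R := Ct * Ce * aE * \sum_(1 <= i < k.+1) ((nk i)%:R ^+ 2 * aE ^- i).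
pose Q k : R := \sum_(1 <= i < k) `|w i - w i.+1|.
have CC0 : 0 <= Ct * Ce * aE by rewrite !mulr_ge0// ltW.
have [||||||||B tB] := @restart_bounded _ _ t e v e0 nk w cost k0 hnk nk1 _
  P Q (Ct * Ce * aE * S1) S2.
- by move=> k N k0k; apply: block.
- by move=> k; rewrite mulr_ge0 ?sumr_ge0.
- by move=> k; rewrite sumr_ge0.
- by [].
- move=> k _; rewrite /P [X in _ <= _ * X]big_nat_recr//= mulrDr lerD2l /cost.
  rewrite le_eqVlt; apply/orP; left; apply/eqP; rewrite (exprS aE); field.
  by rewrite expf_neq0 lt0r_neq0.
- move=> k k0k; rewrite /Q [X in _ <= X]big_nat_recr//=.
  exact: leq_trans k0k.
- by move=> k; rewrite ler_wpM2l.
- by move=> k; exact: S2P.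
by apply: (final B k0) => k N k0k kN; rewrite kappa0 mulr0 powRr0 mulr1 (tB k).
Qed.
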